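(* Let $\Phi=(\varphi_n)_{n\in\mathbb N}$ be a frame for a separable Hilbert space $\mathcal H$. Then the approximately dual frames of $\Phi$ are precisely the families $\Phi^{ad}=(\varphi_n^{ad})_{n\in\mathbb N}$ of the form $$\varphi_n^{ad}=\mathcal D^*S_\Phi^{-1/2}\varphi_n+\Theta^*(\delta_n)\qquad(n\in\mathbb N),$$ where $\Theta\in \mathrm{ran}_{B(\mathcal H,\ell^2)}(T_\Phi)$ and $\mathcal D$ is a bounded operator on $\mathcal H$ with $\|Id_{\mathcal H}-S_\Phi^{1/2}\mathcal D\|<1$. In particular, for such a family, $T_\Phi U_{\Phi^{ad}}=S_\Phi^{1/2}\mathcal D$.
   Context: $\mathcal H$ is a separable Hilbert space, $Id_{\mathcal H}$ the identity operator, $B(\mathcal H,\ell^2)$ the bounded linear operators from $\mathcal H$ to $\ell^2$, and $(\delta_n)_n$ the canonical orthonormal basis of $\ell^2$. A sequence $\Phi=(\varphi_n)_{n\in\mathbb N}$ in $\mathcal H$ is a frame if there are constants $m_\Phi,M_\Phi>0$ with $m_\Phi\|f\|^2\le\sum_{n}|\langle f,\varphi_n\rangle|^2\le M_\Phi\|f\|^2$ for all $f\in\mathcal H$; it is a Bessel sequence with Bessel bound $M_\Phi$ if the second inequality holds. For a Bessel sequence $\Phi$: the analysis operator is $U_\Phi:\mathcal H\to\ell^2$, $U_\Phi f=(\langle f,\varphi_n\rangle)_n$; the synthesis operator is $T_\Phi:\ell^2\to\mathcal H$, $T_\Phi((c_n)_n)=\sum_n c_n\varphi_n$; the frame operator is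 $S_\Phi=T_\Phi U_\Phi$. For a frame $\Phi$, $S_\Phi$ is bounded, positive and invertible; $S_\Phi^{1/2}$ is its positive square root and $S_\Phi^{-1/2}=(S_\Phi^{1/2})^{-1}$. Two Bessel sequences $\Phi,\Phi^{ad}$ are approximately dual frames if $\|Id_{\mathcal H}-T_\Phi U_{\Phi^{ad}}\|<1$ or $\|Id_{\mathcal H}-T_{\Phi^{ad}} U_\Phi\|<1$ (equivalent conditions, by taking adjoints). Set $\mathrm{ran}_{B(\mathcal H,\ell^2)}(T_\Phi):=\{\Theta\in B(\mathcal H,\ell^2): T_\Phi\Theta=0\}$. *)

(* Defs.v *)
From HB Require Import structures.
From mathcomp Require Import all_boot all_order all_algebra.
From mathcomp Require Import sesquilinear complex.
From mathcomp Require Import all_classical all_reals all_analysis.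
From mathcomp Require Import ring lra.

Set Implicit Arguments.
Unset Strict Implicit.
Unset Printing Implicit Defensive.

Import Order.TTheory GRing.Theory Num.Theory Num.Def.
Import numFieldNormedType.Exports.

Local Open Scope classical_set_scope.
Local Open Scope complex_scope.
Local Open Scope ring_scope.

Section CauchySchwarz.
Context (C : numClosedFieldType) (U : lmodType C) (form : {dot U for conjC}).

Lemma dot_CauchySchwarz (u v : U) :
  `|form u v| ^+ 2 <= form u u * form v v.
Proof.
have [->|v0] := eqVneq v 0.
  have E0 w : form w 0 = 0 by exact: linear0r.
  by rewrite !E0 normr0 expr0n mulr0.
have vv0 : 0 < form v v by rewrite dnorm_gt0.
have E : form v u = (form u v)^* by rewrite hermC /= expr0 mul1r.
have vvr : (form v v)^* = form v v by apply/CrealP; exact: gtr0_real.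
have := dnorm_ge0 form (form v v *: u - form u v *: v).
rewrite linearBl/= !linearBr/= !linearZl_LR /= !linearZr_LR/= E vvr normCK.
set p := form u v; set q := form v v; set r := form u u => h.
rewrite -subr_ge0 -(pmulr_rge0 _ vv0) -/q.
by move: h; rewrite /GRing.scale/=; congr (0 <= _); ring.
Qed.

Lemma dot_triangle (u v : U) :
  sqrtC (form (u + v) (u + v)) <= sqrtC (form u u) + sqrtC (form v v).
Proof.
rewrite -(ler_pXn2r (ltn0Sn 1)) ?nnegrE ?addr_ge0 ?sqrtC_ge0 ?dnorm_ge0//.
rewrite sqrrD !sqrtCK dnormD/= [leRHS]addrAC lerD2l.
have -> (z : C) : z + z^* = 'Re z *+ 2.
  by rewrite ReE -mulr_natr divfK// pnatr_eq0.
rewrite lerMn2r/= (le_trans (leif_Re_Creal _))//.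
rewrite -(ler_pXn2r (ltn0Sn 1)) ?nnegrE ?mulr_ge0 ?sqrtC_ge0 ?dnorm_ge0//.
by rewrite exprMn !sqrtCK dot_CauchySchwarz.
Qed.

End CauchySchwarz.

(* Scalars are the complex numbers R[i]; [inner] is linear in its first
   argument and conjugate-linear in the second. *)
HB.mixin Record NormedModule_isInnerProduct (R : realType) H
    & NormedModule R[i] H := {
  inner : {dot H for @conjC R[i]} ;
  sqr_normE : forall x : H, `|x| ^+ 2 = inner x x
}.

#[short(type="innerProductType")]
HB.structure Definition InnerProduct (R : realType) :=
  {H of NormedModule R[i] H & NormedModule_isInnerProduct R H}.

#[short(type="hilbertType")]
HB.structure Definition Hilbert (R : realType) :=
  {H of InnerProduct R H & Complete H}.

Notation "''[' u , v ]" := (inner u%R v%R) : ring_scope.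

(* Norms in a normed module over R[i] take values in R[i]; [rnorm] is the same
   norm as an element of R, for vectors as well as for complex scalars. *)
Definition rnorm (R : realType) (V : normedZmodType R[i]) (x : V) : R :=
  complex.Re `|x|.

(* C is R[i] with its topology, which mathcomp-analysis puts on R[i]^o. *)
Section ell2.
Variable R : realType.
Local Notation C := (R[i]^o).

Definition square_summable : {pred nat -> C} :=
  fun c => `[< cvgn [series rnorm (c n) ^+ 2]_n >].

Record ell2 := Ell2 {
  ell2_val :> nat -> C ;
  ell2_valP : ell2_val \in square_summable }.

HB.instance Definition _ := [isSub for ell2_val].
HB.instance Definition _ := [Choice of ell2 by <:].

Lemma rnorm_ge0 (V : normedZmodType R[i]) (x : V) : 0 <= rnorm x.
Proof. by rewrite /rnorm; have := normr_ge0 x; rewrite lecE => /andP[]. Qed.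

Lemma rnormE (V : normedZmodType R[i]) (x : V) : (rnorm x)%:C = `|x|.
Proof. by rewrite /rnorm RRe_real. Qed.

Lemma rnormD (V : normedZmodType R[i]) (x y : V) :
  rnorm (x + y) <= rnorm x + rnorm y.
Proof. by rewrite -lecR rmorphD/= !rnormE ler_normD. Qed.

Lemma rnormM (x y : R[i]) : rnorm (x * y) = rnorm x * rnorm y.
Proof.
by apply: complexI; rewrite rmorphM/= !rnormE normrM.
Qed.

Lemma square_summable_submod : submod_closed square_summable.
Proof.
split.
  apply/asboolP; rewrite (_ : (fun n => _) = fun=> 0).
    by rewrite /series/=; under eq_fun do rewrite big1//; exact: is_cvg_cst.
  by apply/funext => n; rewrite /rnorm normr0 expr0n.
move=> a c d /asboolP cc /asboolP cd; apply/asboolP.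
apply: (@series_le_cvg _ _ (fun n => 2 * rnorm a ^+ 2 * rnorm (c n) ^+ 2 +
                                   2 * rnorm (d n) ^+ 2)).
- by move=> n /=; rewrite sqr_ge0.
- move=> n /=; have a2 := sqr_ge0 (rnorm a); have := sqr_ge0 (rnorm (c n)); have := sqr_ge0 (rnorm (d n)); nra.
- move=> n /=; rewrite -mulrA -exprMn -rnormM.
  have := rnormD (a * c n) (d n).
  have := rnorm_ge0 (a * c n + d n).
  have := sqr_ge0 (rnorm (a * c n) - rnorm (d n)).
  rewrite /GRing.scale/=; nra.
- under eq_fun do rewrite -mulrA.
  by apply: is_cvg_seriesD; apply: is_cvg_seriesZ => //; apply: is_cvg_seriesZ.
Qed.

HB.instance Definition _ :=
  GRing.isSubmodClosed.Build _ _ square_summable square_summable_submod.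
HB.instance Definition _ := [SubChoice_isSubLmodule of ell2 by <:].

Lemma ell2_summable (c : ell2) : cvgn [series rnorm (c n) ^+ 2]_n.
Proof. exact/asboolP/ell2_valP. Qed.

Lemma ell2P (c d : ell2) : (forall n, c n = d n) -> c = d.
Proof. by move=> cd; apply/val_inj/funext. Qed.

Lemma cvg_complex (u : nat -> C) (l : C) :
  (fun n => complex.Re (u n)) @ \oo --> complex.Re l ->
  (fun n => complex.Im (u n)) @ \oo --> complex.Im l ->
  u @ \oo --> l.
Proof.
move=> /cvgrPdist_lt ure /cvgrPdist_lt uim; apply/cvgrPdist_lt => e e0.
have [e1 e1E] : exists r, e = r%:C.
  by apply/complex_realP; exact: gtr0_real.
move: e0; rewrite {}e1E ltcR => e0.
have e20 : 0 < e1 / 2 by rewrite divr_gt0.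
near=> n.
have Rn : `|complex.Re l - complex.Re (u n)| < e1 / 2 by near: n; exact: ure.
have In : `|complex.Im l - complex.Im (u n)| < e1 / 2 by near: n; exact: uim.
have -> : l - u n = (complex.Re l - complex.Re (u n)) +i*
                    (complex.Im l - complex.Im (u n)).
  by move: (l) (u n) => [? ?] [].
set z := _ +i* _; rewrite [z]complexE /z/= (le_lt_trans (ler_normD _ _))// normrM !normc_def/=.
rewrite !(expr0n, addr0, add0r, expr1n, sqrtr1, mul1r) !sqrtr_sqr -rmorphD/=.
by rewrite ltcR [e1]splitr ltrD.
Unshelve. all: by end_near. Qed.

Definition ell2_inner (c d : ell2) : R[i] :=
  limn ([series c n * (d n)^* ]_n : nat -> C).

Lemma ell2_inner_cvg (c d : ell2) :
  cvgn ([series c n * (d n)^* ]_n : nat -> C).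
Proof.
have H (p : R[i] -> R) : {morph p : x y / x + y} -> p 0 = 0 ->
    (forall z, `|p z| <= rnorm z) ->
    cvgn (fun n => p ([series c n * (d n)^* ]_n n)).
  move=> pD p0 pn.
  rewrite (_ : (fun n => _) = [series p (c n * (d n)^*)]_n); last first.
    by apply/funext => n; rewrite /series/= (big_morph p pD p0).
  apply: normed_cvg.
  apply: (@series_le_cvg _ _ (fun n => rnorm (c n) ^+ 2 + rnorm (d n) ^+ 2)).
  - by move=> n /=.
  - by move=> n /=; rewrite addr_ge0 ?sqr_ge0.
  - move=> n /=; rewrite (le_trans (pn _))// rnormM.
    have -> : rnorm (d n)^* = rnorm (d n) by rewrite /rnorm norm_conjC.
    have := sqr_ge0 (rnorm (c n) - rnorm (d n)).
    have := rnorm_ge0 (c n); have := rnorm_ge0 (d n); nra.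
  - by apply: is_cvg_seriesD; exact: ell2_summable.
have /cvg_ex[/= a ha] : cvgn (fun n => complex.Re ([series c n * (d n)^* ]_n n)).
  apply: H => //; first by move=> [? ?] [].
  by move=> z; rewrite -lecR rnormE normc_ge_Re.
have /cvg_ex[/= b hb] : cvgn (fun n => complex.Im ([series c n * (d n)^* ]_n n)).
  apply: H => //; first by move=> [? ?] [].
  move=> [x y]; rewrite /rnorm normc_def/= -sqrtr_sqr ler_wsqrtr//.
  by rewrite lerDr sqr_ge0.
by apply/cvg_ex; exists (a +i* b); exact: cvg_complex.
Qed.

Lemma ell2_inner_cvgE (c d : ell2) :
  ([series c n * (d n)^* ]_n : nat -> C) @ \oo --> (ell2_inner c d : C).
Proof. exact: ell2_inner_cvg. Qed.

Lemma ell2_inner_linear (d : ell2) : linear_for *%R (ell2_inner^~ d).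
Proof.
move=> a x y; apply/(@cvg_lim C) => //.
rewrite (_ : series _ = fun n =>
    a *: ([series x n * (d n)^* ]_n n : C) + [series y n * (d n)^* ]_n n).
  by apply: cvgD; [apply: cvgZr|]; exact: ell2_inner_cvgE.
apply/funext => n; rewrite /series/= scaler_sumr -big_split/=.
by apply: eq_bigr => i _; rewrite mulrDl /GRing.scale/= mulrA.
Qed.

Lemma ell2_inner_hermitian (x y : ell2) :
  ell2_inner x y = (-1) ^+ false * (ell2_inner y x)^*.
Proof.
rewrite expr0 mul1r; apply/(@cvg_lim C) => //.
rewrite (_ : series _ = fun n => ([series y n * (x n)^* ]_n n)^*).
  apply/cvgrPdist_lt => e e0; near=> n.
  rewrite -rmorphB norm_conjC; near: n.
  by move/cvgrPdist_lt : (@ell2_inner_cvgE y x); exact.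
apply/funext => n; rewrite /series/= rmorph_sum/=.
by apply: eq_bigr => i _; rewrite rmorphM/= conjCK mulrC.
Unshelve. all: by end_near. Qed.

Lemma ell2_inner_linearr (d : ell2) :
  linear_for (@conjC R[i] \; *%R) (ell2_inner d).
Proof.
move=> a x y; rewrite ell2_inner_hermitian ell2_inner_linear.
rewrite (ell2_inner_hermitian d x) (ell2_inner_hermitian d y).
by rewrite expr0 !mul1r rmorphD rmorphM.
Qed.

Lemma ell2_inner_normE (c : ell2) :
  ell2_inner c c = (limn [series rnorm (c n) ^+ 2]_n)%:C.
Proof.
have E n : [series c n * (c n)^* ]_n n = ([series rnorm (c n) ^+ 2]_n n)%:C.
  rewrite /series/= rmorph_sum/=; apply: eq_bigr => i _.
  by rewrite rmorphXn/= rnormE normCK.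
apply/(@cvg_lim C) => //; apply: cvg_complex.
  rewrite /=; under eq_fun do rewrite E/=; exact: ell2_summable.
by rewrite /=; under eq_fun do rewrite E/=; exact: cvg_cst.
Qed.

Lemma ell2_inner_gt0 (c : ell2) : c != 0 -> 0 < ell2_inner c c.
Proof.
move=> c0; rewrite ell2_inner_normE ltcR.
have [n cn0] : exists n, c n != 0.
  apply/not_existsP => h; move/eqP : c0; apply; apply: ell2P => n.
  by apply/eqP/negP => /negP/h.
apply: (@lt_le_trans _ _ ([series rnorm (c n) ^+ 2]_n n.+1)).
  rewrite /series/= big_nat_recr//= ltr_wpDl//.
    by rewrite sumr_ge0// => i _; rewrite sqr_ge0.
  rewrite exprn_gt0// -ltcR rnormE.
  by rewrite normr_gt0.
apply: nondecreasing_cvgn_le; last exact: ell2_summable.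
by apply: nondecreasing_series => k _ _ /=; rewrite sqr_ge0.
Qed.

HB.instance Definition _ :=
  bilinear_isBilinear.Build R[i] ell2 ell2 R[i]
    (GRing.Scale.Law.clone _ _ ( *%R ) _)
    (GRing.Scale.Law.clone _ _ (@conjC R[i] \; *%R ) _)
    ell2_inner (ell2_inner_linear, ell2_inner_linearr).
HB.instance Definition _ :=
  isHermitianSesquilinear.Build R[i] ell2 false (@conjC R[i]) ell2_inner
    ell2_inner_hermitian.
HB.instance Definition _ :=
  isDotProduct.Build R[i] ell2 ell2_inner ell2_inner_gt0.

Definition ell2_norm (c : ell2) : R[i] := sqrtC (ell2_inner c c).

Lemma ell2_normD (c d : ell2) : ell2_norm (c + d) <= ell2_norm c + ell2_norm d.
Proof. exact: dot_triangle. Qed.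

Lemma ell2_normZ a (c : ell2) : ell2_norm (a *: c) = `|a| * ell2_norm c.
Proof.
rewrite /ell2_norm dnormZ sqrtCM ?nnegrE ?dnorm_ge0 ?exprn_ge0//.
by rewrite sqrCK.
Qed.

Lemma ell2_norm0_eq0 (c : ell2) : ell2_norm c = 0 -> c = 0.
Proof. by move=> /eqP; rewrite sqrtC_eq0 dnorm_eq0 => /eqP. Qed.

HB.instance Definition _ :=
  Lmodule_isNormed.Build R[i] ell2 ell2_normD ell2_normZ ell2_norm0_eq0.

Lemma ell2_sqr_normE (c : ell2) : `|c| ^+ 2 = ell2_inner c c.
Proof. exact: sqrtCK. Qed.

HB.instance Definition _ :=
  NormedModule_isInnerProduct.Build R ell2 ell2_sqr_normE.

Lemma delta_square_summable n : (fun k => (k == n)%:R) \in square_summable.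
Proof.
apply/asboolP/cvg_ex; exists 1; apply/cvgrPdist_lt => e e0.
near=> k; rewrite /series/=.
have nk : (n < k)%N by near: k; exact: nbhs_infty_gt.
rewrite (bigD1_seq n) ?mem_index_iota ?iota_uniq//= big1 => [|i /negPf ->].
  by rewrite eqxx /rnorm normr1 expr1n addr0 subrr normr0.
by rewrite /rnorm normr0 expr0n.
Unshelve. all: by end_near. Qed.

Definition ell2_delta n : ell2 := Ell2 (delta_square_summable n).

End ell2.

Section operators.
Context (R : realType).

Definition bounded_operator (H K : innerProductType R) (A : H -> K) :=
  linear A /\ exists M : R, forall x, rnorm (A x) <= M * rnorm x.

(* Extended-real valued, hence +oo (and not a default value) when A is
   unbounded. *)
Definition opnorm (H K : innerProductType R) (A : H -> K) : \bar R :=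
  ereal_sup [set (rnorm (A x))%:E | x in [set x | rnorm x <= 1]].

(* [adjoint], [opsqrt] and [opinv] are the unique maps with the displayed
   property when there is one (for bounded A : H -> K with H complete, for
   bounded positive A with H complete, and for boundedly invertible A,
   respectively), and the zero map otherwise. *)
Definition adjoint (H K : innerProductType R) (A : H -> K) : K -> H :=
  xget (cst 0) [set B | forall x y, '[A x, y] = '[x, B y]].

Definition opsqrt (H : innerProductType R) (A : H -> H) : H -> H :=
  xget (cst 0) [set Q | [/\ bounded_operator Q,
    forall x, 0 <= '[Q x, x] & Q \o Q = A]].

Definition opinv (H K : innerProductType R) (A : H -> K) : K -> H :=
  xget (cst 0) [set B | bounded_operator B /\ cancel A B /\ cancel B A].

End operators.

Definition separable (T : topologicalType) :=
  exists2 A : set T, countable A & dense A.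

Section frames.
Context (R : realType) (H : hilbertType R).
Implicit Types (Phi : nat -> H) (f : H).

Definition bessel Phi := exists2 M : R, 0 < M &
  forall f, (\sum_(0 <= n <oo) (rnorm '[f, Phi n] ^+ 2)%:E
             <= (M * rnorm f ^+ 2)%:E)%E.

Definition frame Phi := exists m M : R, [/\ 0 < m, 0 < M &
  forall f, ((m * rnorm f ^+ 2)%:E
              <= \sum_(0 <= n <oo) (rnorm '[f, Phi n] ^+ 2)%:E
              <= (M * rnorm f ^+ 2)%:E)%E].

(* For a Bessel sequence the coefficients are square summable, so the default
   value 0 is not used. *)
Definition analysis Phi : H -> ell2 R :=
  fun f => insubd 0 (fun n => '[f, Phi n]).

Definition synthesis Phi : ell2 R -> H :=
  fun c => limn [series c n *: Phi n]_n.

Definition frame_operator Phi : H -> H := synthesis Phi \o analysis Phi.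

Definition approx_dual Phi Psi := [/\ bessel Phi, bessel Psi &
  (opnorm (idfun \- (synthesis Phi \o analysis Psi))%R < 1)%E \/
  (opnorm (idfun \- (synthesis Psi \o analysis Phi))%R < 1)%E].

(* The right annihilator of the synthesis operator in B(H, ell2). *)
Definition ran_synthesis Phi : set (H -> ell2 R) :=
  [set Theta | bounded_operator Theta /\ synthesis Phi \o Theta = cst 0].

End frames.

(* Main.v *)
(* The frame operator [S := frame_operator Phi] is self-adjoint, bounded and
   bounded below, so [1 - S / L] is a strict contraction for [L] large; a Neumann
   series inverts [S], and a fixed-point iteration produces a positive square root.
   Uniqueness of the root is never used: any positive [Q] with [Q^2 = S] is
   self-adjoint with inverse [Q S^-1].
   If [Psi] is Bessel, take [D := S^(-1/2) T_Phi U_Psi] and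
   [Theta := U_Psi - U_Phi S^(-1/2) D]; conversely the displayed form says exactly
   that [U_Psi = U_Phi S^(-1/2) D + Theta], and applying [T_Phi] gives
   [T_Phi U_Psi = S^(1/2) D]. *)

Require Import Defs.
From HB Require Import structures.
From mathcomp Require Import all_boot all_order all_algebra.
From mathcomp Require Import sesquilinear complex.
From mathcomp Require Import all_classical all_reals all_analysis.
From mathcomp Require Import ring lra.

Set Implicit Arguments.
Unset Strict Implicit.
Unset Printing Implicit Defensive.

Import Order.TTheory GRing.Theory Num.Theory Num.Def.
Import numFieldNormedType.Exports.

Local Open Scope classical_set_scope.
Local Open Scope complex_scope.
Local Open Scope ring_scope.

(** * Convergence measured by the real-valued norm *)

Section rnorm.
Context (R : realType).

Lemma rnorm0 (V : normedZmodType R[i]) : rnorm (0 : V) = 0 :> R.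
Proof. by rewrite /rnorm normr0. Qed.

Lemma rnorm0_eq0 (V : normedZmodType R[i]) (x : V) : rnorm x = 0 -> x = 0.
Proof. by move=> x0; apply/normr0_eq0; rewrite -rnormE x0. Qed.

Lemma rnormN (V : normedZmodType R[i]) (x : V) : rnorm (- x) = rnorm x.
Proof. by rewrite /rnorm normrN. Qed.

Lemma rnormZ (V : normedModType R[i]) a (x : V) :
  rnorm (a *: x) = rnorm a * rnorm x.
Proof. by apply: complexI; rewrite rmorphM/= !rnormE normrZ. Qed.

Lemma rnorm_real (V : normedModType R[i]) (a : R) (x : V) :
  0 <= a -> rnorm (a%:C *: x) = a * rnorm x.
Proof.
move=> a0; rewrite rnormZ; congr (_ * _).
by apply: complexI; rewrite rnormE ger0_norm// lecR.
Qed.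

Lemma rnorm_conjC (z : R[i]) : rnorm z^* = rnorm z.
Proof. by rewrite /rnorm norm_conjC. Qed.

(** Passes from the [R[i]]-valued radii of the topology to real ones: in the order of [R[i]], every
    positive element is real. *)
Lemma cvg_rnormP (V : normedModType R[i]) (u : nat -> V) (l : V) :
  u @ \oo --> l <-> (fun n => rnorm (l - u n)) @ \oo --> (0 : R).
Proof.
split=> [/cvgrPdist_lt ul|/cvgrPdist_lt ul]; apply/cvgrPdist_lt => e e0.
  have e0C : 0 < e%:C by rewrite ltcR.
  near=> n; rewrite sub0r normrN ger0_norm ?rnorm_ge0// -ltcR rnormE.
  by near: n; exact: ul.
have [r eE] : exists r, e = r%:C by apply/complex_realP; exact: gtr0_real.
rewrite eE ltcR in e0 *.
near=> n; rewrite -rnormE ltcR -[ltLHS]ger0_norm ?rnorm_ge0// -normrN -sub0r.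
by near: n; exact: ul.
Unshelve. all: by end_near. Qed.

Lemma cvg_rnorm_unique (V : normedModType R[i]) (u : nat -> V) (l l' : V) :
  u @ \oo --> l -> u @ \oo --> l' -> l = l'.
Proof. by move=> ul ul'; rewrite -(cvg_lim _ ul)// -(cvg_lim _ ul'). Qed.

Lemma cvg_rnorm (V : normedModType R[i]) (u : nat -> V) (l : V) :
  u @ \oo --> l -> (fun n => rnorm (u n)) @ \oo --> rnorm l.
Proof.
move=> /cvg_rnormP/cvgrPdist_lt ul; apply/cvgrPdist_lt => e e0; near=> n.
have : `|0 - rnorm (l - u n)| < e by near: n; exact: ul.
rewrite sub0r normrN ger0_norm ?rnorm_ge0//; apply: le_lt_trans.
have := rnormD (l - u n) (u n); have := rnormD (u n - l) l.
rewrite !subrK -[rnorm (u n - l)]rnormN opprB => un_le l_le.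
by rewrite ler_norml lerBlDr l_le andbT lerNl opprB lerBlDr.
Unshelve. all: by end_near. Qed.

Lemma rnorm_lim_le (V : normedModType R[i]) (u : nat -> V) (l : V) (M : R) :
  u @ \oo --> l -> (forall n, rnorm (u n) <= M) -> rnorm l <= M.
Proof.
move=> /cvg_rnorm ul uM; apply: (cvgr_to_le ul); exact: nearW.
Qed.

Lemma rnorm_cauchy_cvg (V : hilbertType R) (u : nat -> V) (d : nat -> R) :
  d @ \oo --> 0 -> (forall m n, (m <= n)%N -> rnorm (u n - u m) <= d m) ->
  cvgn u.
Proof.
move=> /cvgrPdist_lt d0 ud; apply: cauchy_cvg; apply: cauchy_exP => e e0.
have [r eE] : exists r, e = r%:C by apply/complex_realP; exact: gtr0_real.
rewrite {}eE ltcR in e0 *.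
have [N _ NP] := d0 _ e0.
(* A ball around [u N] already contains the whole tail, so only the one-sided estimate [m <= n] is
   used. *)
exists (u N); exists N => // n /= Nn.
rewrite -ball_normE/= -rnormE ltcR -rnormN opprB (le_lt_trans (ud _ _ Nn))//.
have := NP N (leqnn N); rewrite /= sub0r normrN; apply: le_lt_trans.
exact: ler_norm.
Qed.

End rnorm.

(** * Inner product spaces *)

Section inner.
Context (R : realType) (H : innerProductType R).
Implicit Types (x y z : H) (a : R[i]).

Lemma innerDl x y z : '[x + y, z] = '[x, z] + '[y, z].
Proof. by rewrite linearDl. Qed.
Lemma innerBl x y z : '[x - y, z] = '[x, z] - '[y, z].
Proof. by rewrite linearBl. Qed.
Lemma innerZl a x z : '[a *: x, z] = a * '[x, z].
Proof. by rewrite linearZl_LR. Qed.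
Lemma innerDr x y z : '[z, x + y] = '[z, x] + '[z, y].
Proof. by rewrite linearDr. Qed.
Lemma innerBr x y z : '[z, x - y] = '[z, x] - '[z, y].
Proof. by rewrite linearBr. Qed.
Lemma innerZr a x z : '[z, a *: x] = a^* * '[z, x].
Proof. by rewrite linearZr_LR. Qed.
Lemma innerC x y : '[x, y] = ('[y, x])^*.
Proof. by rewrite hermC /= expr0 mul1r. Qed.

Lemma inner_rnorm x : '[x, x] = (rnorm x ^+ 2)%:C.
Proof. by rewrite -sqr_normE rmorphXn/= rnormE. Qed.

Lemma Re_inner_rnorm x : complex.Re '[x, x] = rnorm x ^+ 2.
Proof. by rewrite inner_rnorm. Qed.

Lemma rnorm_inner x y : rnorm '[x, y] <= rnorm x * rnorm y.
Proof.
rewrite -(ler_pXn2r (ltn0Sn 1)) ?nnegrE ?mulr_ge0 ?rnorm_ge0//.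
rewrite -lecR exprMn [leRHS]rmorphM/= -!inner_rnorm rmorphXn/= rnormE.
exact: dot_CauchySchwarz.
Qed.

Lemma inner_inj x y : (forall z, '[x, z] = '[y, z]) -> x = y.
Proof.
move=> xy; apply/subr0_eq/rnorm0_eq0; apply/eqP; rewrite -sqrf_eq0.
by rewrite -Re_inner_rnorm innerBl xy subrr.
Qed.

Lemma inner_injr x y : (forall z, '[z, x] = '[z, y]) -> x = y.
Proof. by move=> xy; apply: inner_inj => z; rewrite innerC xy -innerC. Qed.

Lemma cvg_innerl (u : nat -> H) l y :
  u @ \oo --> l -> (fun n => '[u n, y] : R[i]^o) @ \oo --> ('[l, y] : R[i]^o).
Proof.
move=> /cvg_rnormP ul; apply/cvg_rnormP.
apply: (@squeeze_cvgr _ _ _ _ (cst 0) (fun n => rnorm (l - u n) * rnorm y)).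
- by near=> n; rewrite /= rnorm_ge0/= -innerBl rnorm_inner.
- exact: cvg_cst.
- by rewrite -(mul0r (rnorm y)); apply: cvgMl.
Unshelve. all: by end_near. Qed.

Lemma rnorm_le_of_sqr (x : H) (M : R) : 0 <= M ->
  rnorm x ^+ 2 <= M * rnorm x -> rnorm x <= M.
Proof.
move=> M0; have := rnorm_ge0 x; rewrite le_eqVlt => /orP[/eqP <-//|x0].
by rewrite expr2 ler_pM2r.
Qed.

End inner.

(** * Bounded operators, adjoints and operator norms *)

Section linear_maps.
Context (R : realType) (H K : innerProductType R).

Lemma linear_funD (A : H -> K) x y : linear A -> A (x + y) = A x + A y.
Proof. by move=> lA; have := lA 1 x y; rewrite !scale1r. Qed.

Lemma linear_fun0 (A : H -> K) : linear A -> A 0 = 0.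
Proof. by move=> lA; apply: (addrI (A 0)); rewrite -linear_funD// !addr0. Qed.

Lemma linear_funZ (A : H -> K) a x : linear A -> A (a *: x) = a *: A x.
Proof. by move=> lA; have := lA a x 0; rewrite linear_fun0// !addr0. Qed.

Lemma linear_funB (A : H -> K) x y : linear A -> A (x - y) = A x - A y.
Proof. by move=> lA; rewrite linear_funD// -(scaleN1r y) linear_funZ// scaleN1r. Qed.

Lemma bounded_operator_ge0 (A : H -> K) : bounded_operator A ->
  exists2 M : R, 0 <= M & forall x, rnorm (A x) <= M * rnorm x.
Proof.
move=> [_ [M AM]]; exists `|M| => // x; apply: le_trans (AM x) _.
by rewrite ler_wpM2r ?rnorm_ge0 ?ler_norm.
Qed.

Lemma bounded_operatorB (A B : H -> K) : bounded_operator A ->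
  bounded_operator B -> bounded_operator (fun x => A x - B x).
Proof.
move=> [lA [M AM]] [lB [N BN]]; split=> [a x y|].
  by rewrite lA lB scalerBr opprD addrACA.
exists (M + N) => x; rewrite (le_trans (rnormD _ _))// rnormN mulrDl.
exact: lerD.
Qed.

Lemma bounded_operatorD (A B : H -> K) : bounded_operator A ->
  bounded_operator B -> bounded_operator (fun x => A x + B x).
Proof.
move=> [lA [M AM]] [lB [N BN]]; split=> [a x y|].
  by rewrite lA lB scalerDr addrACA.
exists (M + N) => x; rewrite (le_trans (rnormD _ _))// mulrDl.
exact: lerD.
Qed.

(** Adjointness as a relation, so that one can compute with a concrete adjoint without going through
    the choice made in [adjoint]. *)
Definition adjoint_pair (A : H -> K) (B : K -> H) :=
  forall x y, '[A x, y] = '[x, B y].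

Lemma adjoint_pair_eq A B : adjoint_pair A B -> adjoint A = B.
Proof.
move=> AB; have := @xgetPex _ (cst 0) [set B | adjoint_pair A B] (ex_intro _ B AB).
rewrite -[xget _ _]/(adjoint A) => AA.
by apply/funext => y; apply: inner_injr => x; rewrite -AA AB.
Qed.

Lemma adjoint_pair_linear A B : adjoint_pair A B -> linear A.
Proof.
move=> AB a x y; apply: inner_inj => z.
by rewrite AB !innerDl !innerZl !AB.
Qed.

(** Testing at [x = B y] gives [|B y|^2 = <A (B y), y> <= M |B y| |y|], and one factor [|B y|]
    cancels. *)
Lemma adjoint_pair_le A B (M : R) : 0 <= M -> adjoint_pair A B ->
  (forall x, rnorm (A x) <= M * rnorm x) ->
  forall y, rnorm (B y) <= M * rnorm y.
Proof.
move=> M0 AB AM y; apply: rnorm_le_of_sqr; first by rewrite mulr_ge0 ?rnorm_ge0.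
rewrite -Re_inner_rnorm -AB (@le_trans _ _ (rnorm '[A (B y), y]))//.
  by rewrite -lecR rnormE (le_trans _ (normc_ge_Re _))// lecR ler_norm.
rewrite (le_trans (rnorm_inner _ _))// mulrAC.
by rewrite ler_wpM2r ?rnorm_ge0.
Qed.

(** Lying between 0 and 1, the extended-real supremum is finite and can itself serve as [c]; a
    general [x] is rescaled to the unit sphere. *)
Lemma opnorm_lt1 (A : H -> K) : linear A -> (opnorm A < 1)%E ->
  exists2 c : R, 0 <= c < 1 & forall x, rnorm (A x) <= c * rnorm x.
Proof.
move=> lA A1.
have A_le x : rnorm x <= 1 -> ((rnorm (A x))%:E <= opnorm A)%E.
  by move=> x1; apply: ereal_sup_ubound; exists x.
have A0 : (0 <= opnorm A)%E.
  by have := A_le 0; rewrite linear_fun0// !rnorm0; exact.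
have /fineK opA : opnorm A \is a fin_num.
  by rewrite ge0_fin_numE// (lt_trans A1)// ltry.
exists (fine (opnorm A)).
  by rewrite fine_ge0//= -lte_fin opA.
move=> x; have [->|x0] := eqVneq x 0; first by rewrite linear_fun0// !rnorm0 mulr0.
have nx0 : 0 < rnorm x.
  by rewrite lt_def rnorm_ge0 andbT; apply: contra_neq x0; exact: rnorm0_eq0.
have := A_le ((rnorm x)^-1%:C *: x).
rewrite linear_funZ// !rnorm_real ?invr_ge0 ?rnorm_ge0// mulVf ?gt_eqF//.
by rewrite lexx -[X in (_ <= X)%E]opA lee_fin ler_pdivrMl// mulrC => /(_ isT).
Qed.

Lemma opnorm_le (A : H -> K) (c : R) : 0 <= c ->
  (forall x, rnorm (A x) <= c * rnorm x) -> (opnorm A <= c%:E)%E.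
Proof.
move=> c0 Ac; apply: ge_ereal_sup => _ [x /= x1 <-].
by rewrite lee_fin (le_trans (Ac _))// ler_piMr.
Qed.

End linear_maps.

Lemma bounded_operator_comp (R : realType) (H K L : innerProductType R)
  (A : K -> L) (B : H -> K) :
  bounded_operator A -> bounded_operator B -> bounded_operator (A \o B).
Proof.
move=> bA bB; split=> [a x y|]; first by rewrite /= bB.1 bA.1.
have [M M0 AM] := bounded_operator_ge0 bA.
have [N _ BN] := bounded_operator_ge0 bB.
by exists (M * N) => x; rewrite /= (le_trans (AM _))// -mulrA ler_wpM2l.
Qed.

Lemma adjoint_pair_sym (R : realType) (H K : innerProductType R)
  (A : H -> K) B : adjoint_pair A B -> adjoint_pair B A.
Proof. by move=> AB x y; rewrite innerC -AB -innerC. Qed.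

(** This makes the two alternatives in [approx_dual] equivalent. *)
Lemma opnorm_adjoint_lt1 (R : realType) (H K : innerProductType R)
  (A : H -> K) B : adjoint_pair A B -> (opnorm A < 1 -> opnorm B < 1)%E.
Proof.
move=> AB /(opnorm_lt1 (adjoint_pair_linear AB))[c /andP[c0 c1] Ac].
rewrite (@le_lt_trans _ _ c%:E)//; apply: opnorm_le => //.
exact: adjoint_pair_le AB Ac.
Qed.

(* Polarization: the sesquilinear form [h x y := '[Q x, y] - '[x, Q y]] vanishes
   on the diagonal, hence everywhere, the scalars being complex. *)
Lemma positive_adjoint_pair (R : realType) (H : innerProductType R)
  (Q : H -> H) : linear Q -> (forall x, 0 <= '[Q x, x]) -> adjoint_pair Q Q.
Proof.
move=> lQ Q0.
pose h x y : R[i] := '[Q x, y] - '[x, Q y].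
have h0 x : h x x = 0.
  rewrite /h [X in _ - X]innerC.
  by have /CrealP -> := ger0_real (Q0 x); rewrite subrr.
(* Expand [h (a y + x) (a y + x) = 0] and drop the diagonal terms. *)
have hD a x y : a^* * h x y + a * h y x = 0.
  have := h0 (a *: y + x); have := h0 x; have := h0 y.
  rewrite /h lQ !(innerDl, innerDr, innerZl, innerZr) => hy hx.
  have -> : '[Q y, y] = '[y, Q y] by apply/eqP; rewrite -subr_eq0 hy.
  have -> : '[Q x, x] = '[x, Q x] by apply/eqP; rewrite -subr_eq0 hx.
  by move=> <-; ring.
(* The choice [a = 1] makes [h] antisymmetric and [a = 'i] makes it symmetric, hence it vanishes. *)
move=> x y; apply/subr0_eq; rewrite -/(h x y).
have := hD 1 x y; rewrite rmorph1 !mul1r => /eqP; rewrite addr_eq0 => /eqP hyx.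
have := hD 'i x y; rewrite conjCi hyx mulrNN mulrC => /eqP.
have i2 : 'i + 'i != 0 :> R[i] by rewrite -mulr2n mulrn_eq0/= neq0Ci.
rewrite mulrC -mulrDl mulf_eq0 (negbTE i2)/= => /eqP ->.
by rewrite oppr0.
Qed.

(** * Geometric convergence and inversion of [1 - A] *)

Section Neumann.
Context (R : realType) (H : hilbertType R).

Lemma geometric_cvg (u : nat -> H) (C q : R) : 0 <= C -> 0 <= q < 1 ->
  (forall n, rnorm (u n.+1 - u n) <= C * q ^+ n) -> cvgn u.
Proof.
move=> C0 /andP[q0 q1] uq; have q1' : 0 < 1 - q by rewrite subr_gt0.
apply: (@rnorm_cauchy_cvg _ _ _ (fun m => C / (1 - q) * q ^+ m)).
  by rewrite -(mulr0 (C / (1 - q))); apply: cvgMr; apply: cvg_expr; rewrite ger0_norm.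
(* Keeping the term [q ^+ (m + k)] makes the induction step an exact identity of geometric sums; it
   is dropped only at the end. *)
have tele m k : rnorm (u (m + k)%N - u m) <= C / (1 - q) * (q ^+ m - q ^+ (m + k)).
  elim: k => [|k IH]; first by rewrite addn0 !subrr rnorm0 mulr0.
  rewrite addnS -(subrK (u (m + k)%N) (u (m + k).+1)) -addrA.
  rewrite (le_trans (rnormD _ _))// (le_trans (lerD (uq _) IH))//.
  rewrite exprS le_eqVlt; apply/orP; left; apply/eqP; field.
  by rewrite gt_eqF.
move=> m n mn; have := tele m (n - m)%N; rewrite subnKC// => /le_trans; apply.
by rewrite ler_wpM2l ?divr_ge0 ?(ltW q1')// gerBl exprn_ge0.
Qed.

Lemma Neumann (A : H -> H) (q : R) : linear A -> 0 <= q < 1 ->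
  (forall x, rnorm (A x) <= q * rnorm x) ->
  exists B : H -> H, [/\ bounded_operator B,
    cancel (fun x => x - A x) B & cancel B (fun x => x - A x)].
Proof.
move=> lA q01 Aq; have /andP[q0 q1] := q01.
have q1' : 0 < 1 - q by rewrite subr_gt0.
(* This lower bound gives both injectivity of [1 - A] and the bound [(1 - q)^-1] on its inverse. *)
have A_inj x : (1 - q) * rnorm x <= rnorm (x - A x).
  rewrite mulrBl mul1r lerBlDr -{1}(subrK (A x) x).
  by rewrite (le_trans (rnormD _ _))// lerD2l.
(* The iterates of [x |-> y + A x] from 0 are the partial sums of the series of [A^k y]; their
   increments have norm at most [q^n |y|]. *)
have A_surj y : {x | x - A x = y}.
  apply: cid; pose u n := iter n (fun x => y + A x) 0.
  have /cvg_ex[x ux] : cvgn u.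
    apply: (@geometric_cvg _ (rnorm y) q); rewrite ?rnorm_ge0//.
    elim=> [|n IH]; first by rewrite /u/= linear_fun0// addr0 subr0 expr0 mulr1.
    rewrite {1}/u !iterS -!/(u _) opprD addrACA subrr add0r -linear_funB//.
    by rewrite (le_trans (Aq _))// exprS mulrCA ler_wpM2l.
  exists x; apply/eqP; rewrite subr_eq; apply/eqP.
  have uSx : (fun n => u n.+1) @ \oo --> x by rewrite (cvg_shiftS u).
  apply: cvg_rnorm_unique uSx _; apply/cvg_rnormP; rewrite /u/=.
  move/cvg_rnormP : ux => ux.
  apply: (@squeeze_cvgr _ _ _ _ (cst 0) (fun n => q * rnorm (x - u n))).
  - near=> n; rewrite /= rnorm_ge0/= opprD addrACA subrr add0r -linear_funB//.
  - exact: cvg_cst.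
  - by rewrite -(mulr0 q); apply: cvgMr.
pose B y := sval (A_surj y).
have BK y : B y - A (B y) = y by rewrite /B; case: (A_surj y).
have inj x y : x - A x = y - A y -> x = y.
  move=> xy; apply/subr0_eq/rnorm0_eq0/eqP; rewrite eq_le rnorm_ge0 andbT.
  rewrite -(pmulr_rle0 _ q1') (le_trans (A_inj _))// linear_funB//.
  by rewrite opprD addrACA -opprD xy subrr rnorm0.
exists B; split => //; last by move=> x; apply: inj; rewrite BK.
split.
  move=> a x y; apply: inj; rewrite BK lA -{1}(BK x) -{1}(BK y).
  by rewrite scalerBr opprD addrACA.
exists (1 - q)^-1 => x.
by rewrite ler_pdivlMl// (le_trans (A_inj _))// BK.
Unshelve. all: by end_near. Qed.

End Neumann.

(** * Square roots and inverses of coercive self-adjoint operators *)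

Section square_root.
Context (R : realType) (H : hilbertType R).

(* The limit [Y] of the iteration [Y := (A + Y^2) / 2], a contraction of the
   ball of radius [q], satisfies [(1 - Y)^2 = 1 - A]. *)
Lemma sqrt_iteration (A : H -> H) (q : R) : 0 <= q < 1 -> adjoint_pair A A ->
  (forall x, rnorm (A x) <= q * rnorm x) ->
  exists Y : H -> H, [/\ adjoint_pair Y Y,
    forall x, rnorm (Y x) <= q * rnorm x &
    forall x, Y x + Y x = A x + Y (Y x)].
Proof.
move=> q01 AA Aq; have /andP[q0 q1] := q01.
pose h : R[i] := 2^-1%:C.
have hE (x : H) : rnorm (h *: x) = 2^-1 * rnorm x by rewrite rnorm_real.
have hconj : h^* = h by apply/CrealP/ger0_real; rewrite lecR invr_ge0.
have hh : h + h = 1 by rewrite /h -rmorphD/= -mulr2n -[2^-1 *+ 2]mulr_natl mulfV.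
pose u n := iter n (fun Y x => h *: (A x + Y (Y x))) (fun=> 0 : H).
have uS n x : u n.+1 x = h *: (A x + u n (u n x)) by [].
have uadj n : adjoint_pair (u n) (u n).
  elim: n => [|n IH] x y; first by rewrite linear0l linear0r.
  by rewrite !uS innerZl innerZr hconj innerDl innerDr AA !IH.
have ulin n := adjoint_pair_linear (uadj n).
(* The ball of radius [q] is preserved because [(q + q^2) / 2 <= q]. *)
have uq n x : rnorm (u n x) <= q * rnorm x.
  elim: n x => [|n IH] x; first by rewrite rnorm0 mulr_ge0 ?rnorm_ge0.
  rewrite uS hE; have := rnormD (A x) (u n (u n x)); have := Aq x; have := IH x.
  have := IH (u n x); have := rnorm_ge0 x; have := rnorm_ge0 (u n x).
  move: q0 q1; clear; nra.
have udiff n x : rnorm (u n.+1 x - u n x) <= rnorm x * q ^+ n.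
  elim: n x => [|n IH] x.
    rewrite subr0 expr0 mulr1 (le_trans (uq 1%N x))//.
    by rewrite ler_piMl ?rnorm_ge0// ltW.
  (* Writing [V = u n.+1] and [W = u n], split [V^2 - W^2 = V (V - W) + (V - W) W], which holds
     without commutation. The induction hypothesis is applied at [x] and at [u n x], and each half
     contributes at most [q^(n+1) |x| / 2]. *)
  have -> : u n.+2 x - u n.+1 x =
      h *: (u n.+1 (u n.+1 x - u n x) + (u n.+1 (u n x) - u n (u n x))).
    rewrite [u n.+2 x]uS [in X in _ - X]uS -scalerBr opprD addrACA subrr add0r.
    by rewrite (linear_funB _ _ (ulin n.+1)) subrKA.
  rewrite hE exprS.
  have := rnormD (u n.+1 (u n.+1 x - u n x)) (u n.+1 (u n x) - u n (u n x)).
  have := uq n.+1 (u n.+1 x - u n x); have := IH (u n x); have := IH x.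
  have := uq n x; have := exprn_ge0 n q0; set t := q ^+ n.
  have := rnorm_ge0 x; have := rnorm_ge0 (u n x).
  have := rnorm_ge0 (u n.+1 x - u n x).
  set a := rnorm (_ + _); set b := rnorm (u n.+1 (_ - _)).
  set c := rnorm (u n.+1 (u n x) - _); set d := rnorm (u n.+1 x - _).
  set e := rnorm (u n x); set f := rnorm x.
  move=> d0 e0 f0 t0 ef df ce bd abc.
  have : q * d <= q * (f * t) by rewrite ler_wpM2l.
  have : e * t <= q * f * t by rewrite ler_wpM2r.
  by move: abc bd ce; clear; lra.
have ucvg x : {l : H | (fun n => u n x) @ \oo --> l}.
  apply: cid; apply/cvg_ex.
  apply: (geometric_cvg (rnorm_ge0 x) q01) => n.
  exact: udiff.
pose Y x := sval (ucvg x).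
have uY x : (fun n => u n x) @ \oo --> Y x by rewrite /Y; case: (ucvg x).
have Yq x : rnorm (Y x) <= q * rnorm x.
  exact: rnorm_lim_le (uY x) _.
have YY : adjoint_pair Y Y.
  move=> x y; rewrite [RHS]innerC.
  apply: (@cvg_rnorm_unique _ R[i]^o (fun n => '[u n x, y])).
    exact: cvg_innerl.
  apply/cvg_rnormP; under eq_fun do rewrite uadj (innerC x) -rmorphB rnorm_conjC.
  apply/(@cvg_rnormP R R[i]^o (fun n => '[u n y, x]) '[Y y, x]).
  exact: cvg_innerl.
exists Y; split => // x.
apply: (@cvg_rnorm_unique _ _ (fun n => u n.+1 x + u n.+1 x)).
  by apply: cvgD; have /= := uY x; rewrite -(cvg_shiftS (fun n => u n x)).
under eq_fun do rewrite uS -scalerDl hh scale1r.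
apply: cvgD; first exact: cvg_cst.
apply/cvg_rnormP.
(* Convergence is only pointwise, so [Y (Y x) - u n (u n x)] is split at [u n (Y x)]; the uniform
   bound [q] on the [u n] controls the second piece. *)
apply: (@squeeze_cvgr _ _ _ _ (cst 0)
  (fun n => rnorm (Y (Y x) - u n (Y x)) + q * rnorm (Y x - u n x))).
- near=> n; rewrite /= rnorm_ge0/= -(subrKA (u n (Y x))).
  by rewrite (le_trans (rnormD _ _))// lerD2l -linear_funB.
- exact: cvg_cst.
- rewrite -(addr0 0); apply: cvgD; first exact/cvg_rnormP.
  by rewrite -(mulr0 q); apply: cvgMr; exact/cvg_rnormP.
Unshelve. all: by end_near. Qed.

(* With [K] a bound for [S], [|x - S x / L|^2 <= (1 - 2 m / L + K^2 / L^2) |x|^2],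
   and [L] is chosen so that [K^2 / L <= m]. *)
Lemma coercive_contraction (S : H -> H) (m : R) :
  adjoint_pair S S -> bounded_operator S -> 0 < m ->
  (forall x, m * rnorm x ^+ 2 <= complex.Re '[S x, x]) ->
  exists L q : R, [/\ 0 < L, 0 <= q < 1 &
    forall x, rnorm (x - L^-1%:C *: S x) <= q * rnorm x].
Proof.
move=> SS bS m0 Sm; have [K K0 SK] := bounded_operator_ge0 bS.
pose L := (K ^+ 2 + 1) / m + m.
have L0 : 0 < L by rewrite addr_gt0// divr_gt0// ltr_wpDl ?sqr_ge0.
have mL : m / L <= 1.
  by rewrite ler_pdivrMr// mul1r lerDr divr_ge0 ?(ltW m0)// addr_ge0 ?sqr_ge0.
have KL : K ^+ 2 / L <= m.
  rewrite ler_pdivrMr// /L mulrDr mulrC divfK ?gt_eqF//.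
  by rewrite -addrA lerDl addr_ge0// -expr2 sqr_ge0.
(* In the expansion of the square, the quadratic term is at most [m / L] times [|x|^2] and absorbs
   half of the [- 2 m / L], leaving [q^2 = 1 - m / L]. The summand [m] in [L] keeps this
   nonnegative. *)
exists L, (Num.sqrt (1 - m / L)); split => //.
  rewrite sqrtr_ge0/= -[ltRHS]sqrtr1 ltr_sqrt//.
  by rewrite gtrBl divr_gt0.
move=> x; rewrite -(ler_pXn2r (ltn0Sn 1)) ?nnegrE ?mulr_ge0 ?rnorm_ge0 ?sqrtr_ge0//.
rewrite exprMn sqr_sqrtr ?subr_ge0//.
have -> : rnorm (x - L^-1%:C *: S x) ^+ 2 =
    rnorm x ^+ 2 - 2 * (complex.Re '[S x, x] / L) + (rnorm (S x) / L) ^+ 2.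
  have cL : (L^-1%:C : R[i])^* = L^-1%:C.
    by apply/CrealP/ger0_real; rewrite lecR invr_ge0 ltW.
  have SxE : '[S x, x] = (complex.Re '[S x, x])%:C.
    by rewrite RRe_real// CrealE/= -innerC SS.
  apply: complexI; rewrite -inner_rnorm innerBl !innerBr !innerZl !innerZr cL.
  rewrite -SS {1 2}SxE !inner_rnorm rmorphD/= rmorphB/= !rmorphM/=.
  by ring.
have SmL : m * rnorm x ^+ 2 / L <= complex.Re '[S x, x] / L.
  by rewrite ler_pM2r ?invr_gt0.
have SxL : (rnorm (S x) / L) ^+ 2 <= m * rnorm x ^+ 2 / L.
  rewrite expr_div_n [L ^+ 2]expr2 invfM mulrA ler_pM2r ?invr_gt0//.
  rewrite (@le_trans _ _ (K ^+ 2 / L * rnorm x ^+ 2))//.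
    rewrite [leRHS]mulrAC ler_pM2r ?invr_gt0// -exprMn.
    by rewrite ler_pXn2r ?nnegrE ?mulr_ge0 ?rnorm_ge0.
  by rewrite ler_wpM2r ?sqr_ge0.
rewrite mulrBl mul1r [m / L * _]mulrAC.
by move: SmL SxL; lra.
Qed.

(** With [A = 1 - S / L] and [(1 - Y)^2 = 1 - A], the operator [sqrt L (1 - Y)] squares to [S]. It
    is positive because [<Y x, x> <= q |x|^2]. *)
Lemma coercive_opsqrt (S : H -> H) (m : R) :
  adjoint_pair S S -> bounded_operator S -> 0 < m ->
  (forall x, m * rnorm x ^+ 2 <= complex.Re '[S x, x]) ->
  [/\ bounded_operator (opsqrt S), adjoint_pair (opsqrt S) (opsqrt S)
    & opsqrt S \o opsqrt S = S].
Proof.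
move=> SS bS m0 Sm.
have [L [q [L0 q01 Aq]]] := coercive_contraction SS bS m0 Sm.
have cR (a : R) : 0 <= a -> (a%:C : R[i])^* = a%:C.
  by move=> a0; apply/CrealP/ger0_real; rewrite lecR.
pose A x := x - L^-1%:C *: S x.
have AA : adjoint_pair A A.
  move=> x y; rewrite /A innerBl innerBr innerZl innerZr SS cR//.
  by rewrite invr_ge0 ltW.
have [Y [YY Yq YE]] := sqrt_iteration q01 AA Aq.
have lY := adjoint_pair_linear YY.
pose s : R := Num.sqrt L; have s0 : 0 < s by rewrite sqrtr_gt0.
pose Q x := s%:C *: (x - Y x).
have [Qb Q0 QQ] : [/\ bounded_operator Q, forall x, 0 <= '[Q x, x] & Q \o Q = S].
  split.
  - split=> [a x y|].
      by rewrite /Q lY opprD addrACA -scalerBr scalerDr !scalerA mulrC.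
    exists (s * (1 + q)) => x; rewrite /Q rnorm_real ?(ltW s0)// -mulrA.
    rewrite ler_pM2l// (le_trans (rnormD _ _))// rnormN mulrDl mul1r.
    by rewrite lerD2l.
  - move=> x; rewrite /Q innerZl mulr_ge0 ?lecR ?(ltW s0)// innerBl inner_rnorm.
    have /andP[q0 q1] := q01.
    have YxE : '[Y x, x] = (complex.Re '[Y x, x])%:C.
      by rewrite RRe_real// CrealE/= -innerC YY.
    rewrite YxE subr_ge0 lecR (@le_trans _ _ (rnorm '[Y x, x]))//.
      by rewrite -lecR rnormE (le_trans _ (normc_ge_Re _))// lecR ler_norm.
    rewrite (le_trans (rnorm_inner _ _))// expr2 ler_wpM2r ?rnorm_ge0//.
    by rewrite (le_trans (Yq _))// ler_piMl ?rnorm_ge0// ltW.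
  - apply/funext => x; rewrite /Q/= (linear_funZ _ _ lY) (linear_funB _ _ lY).
    rewrite -!scalerBr scalerA -rmorphM/= -expr2 sqr_sqrtr ?(ltW L0)//.
    have -> : x - Y x - (Y x - Y (Y x)) = L^-1%:C *: S x.
      rewrite opprB [Y (Y x) - _]addrC addrA -[x - _ - _]addrA -opprD YE.
      by rewrite opprD addrA addrNK /A opprB addrC subrK.
    by rewrite scalerA -rmorphM/= mulfV ?gt_eqF// scale1r.
(* The existence of [Q] ensures that [opsqrt S] has the defining properties; its self-adjointness
   then comes from its positivity. *)
have := @xgetPex _ (cst 0) [set Q | [/\ bounded_operator Q,
    forall x, 0 <= '[Q x, x] & Q \o Q = S]] (ex_intro _ Q (And3 Qb Q0 QQ)).
rewrite -[xget _ _]/(opsqrt S) => -[bT T0 TT]; split => //.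
exact: positive_adjoint_pair bT.1 T0.
Qed.

(** [S / L] is 1 minus a strict contraction, so its Neumann inverse composed with division by [L]
    inverts [S]. *)
Lemma coercive_inverse (S : H -> H) (m : R) :
  adjoint_pair S S -> bounded_operator S -> 0 < m ->
  (forall x, m * rnorm x ^+ 2 <= complex.Re '[S x, x]) ->
  exists B : H -> H, [/\ bounded_operator B, cancel S B & cancel B S].
Proof.
move=> SS bS m0 Sm.
have [L [q [L0 q01 Aq]]] := coercive_contraction SS bS m0 Sm.
have lS := bS.1.
have lA : linear (fun x => x - L^-1%:C *: S x).
  by move=> a x y; rewrite lS scalerDr opprD scalerA mulrC -scalerA addrACA -scalerBr.
have [B [bB AB BA]] := Neumann lA q01 Aq.
have SE x : L^-1%:C *: S x = x - (x - L^-1%:C *: S x).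
  by rewrite opprB addrCA subrr addr0.
have LV : L%:C * L^-1%:C = 1 :> R[i] by rewrite -rmorphM/= mulfV ?gt_eqF.
exists (fun x => B (L^-1%:C *: x)); split.
- apply: (bounded_operator_comp bB); split => [a x y|].
    by rewrite scalerDr !scalerA mulrC.
  by exists L^-1 => x; rewrite rnorm_real// invr_ge0 ltW.
- by move=> x; rewrite SE AB.
- move=> y; rewrite -[S _]scale1r -LV -scalerA SE BA.
  by rewrite scalerA LV scale1r.
Qed.

Lemma opinvP (A B : H -> H) : bounded_operator B -> cancel A B -> cancel B A ->
  [/\ bounded_operator (opinv A), cancel A (opinv A) & cancel (opinv A) A].
Proof.
move=> bB AB BA.
have := @xgetPex _ (cst 0) [set B | bounded_operator B /\ cancel A B /\ cancel B A]
  (ex_intro _ B (conj bB (conj AB BA))).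
by rewrite -[xget _ _]/(opinv A) => -[? []].
Qed.

Lemma coercive_opsqrt_inv (S : H -> H) (m : R) :
  adjoint_pair S S -> bounded_operator S -> 0 < m ->
  (forall x, m * rnorm x ^+ 2 <= complex.Re '[S x, x]) ->
  [/\ bounded_operator (opinv (opsqrt S)),
      adjoint_pair (opinv (opsqrt S)) (opinv (opsqrt S)),
      cancel (opsqrt S) (opinv (opsqrt S)) &
      cancel (opinv (opsqrt S)) (opsqrt S)].
Proof.
move=> SS bS m0 Sm.
have [bQ QQ QS] := coercive_opsqrt SS bS m0 Sm.
have [B [bB SB BS]] := coercive_inverse SS bS m0 Sm.
set Q := opsqrt S in bQ QQ QS *.
have SE x : S x = Q (Q x) by rewrite -QS.
(* [Q S^-1] is a right inverse of [Q] since [Q^2 = S], and a left inverse too, as injectivity of [S]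
   makes [Q] injective. *)
have QBK : cancel (Q \o B) Q by move=> x /=; rewrite -SE BS.
have KQB : cancel Q (Q \o B).
  have Qi : injective Q by move=> x y xy; rewrite -(SB x) -(SB y) !SE xy.
  by move=> x; apply: Qi; rewrite QBK.
have [bP PQ QP] := opinvP (bounded_operator_comp bQ bB) KQB QBK.
split => // x y.
by rewrite -{1}(QP y) -QQ QP.
Qed.

End square_root.

(** * Norm and coordinates in [ell2] *)

Section ell2_facts.
Context (R : realType).

Lemma ell2_rnorm (c : ell2 R) :
  rnorm c ^+ 2 = limn [series rnorm (c n) ^+ 2]_n.
Proof. by rewrite -Re_inner_rnorm [inner c c]ell2_inner_normE. Qed.

(** Connects the extended-real series in [bessel] and [frame] with the norm of [ell2]. *)
Lemma nneseries_ell2 (c : ell2 R) :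
  (\sum_(0 <= n <oo) (rnorm (c n) ^+ 2)%:E = (rnorm c ^+ 2)%:E)%E.
Proof.
rewrite ell2_rnorm -EFin_lim; last exact: ell2_summable.
by congr (limn _); apply/funext => n; rewrite /= /series/= sumEFin.
Qed.

Lemma inner_ell2_delta (c : ell2 R) n : '[c, ell2_delta R n] = c n.
Proof.
apply/(@cvg_lim R[i]^o) => //.
(* A partial sum of length [k] stops before index [k], so from length [n.+1] on the sums contain the
   [n]-th term and are constant. *)
rewrite -(cvg_shiftn n.+1).
apply: (@cvg_trans _ ((fun=> c n) @ \oo)); last exact: cvg_cst.
apply: near_eq_cvg; near=> k; rewrite /= /series/=.
rewrite (bigD1_seq n) ?mem_index_iota ?iota_uniq//=; last by rewrite addnS ltnS leq_addl.
rewrite eqxx rmorph1 mulr1 big1 ?addr0// => i /negPf ->.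
by rewrite rmorph0 mulr0.
Unshelve. all: by end_near. Qed.

Lemma bounded_square_summable (c : nat -> R[i]^o) (M : R) :
  (forall n, \sum_(0 <= k < n) rnorm (c k) ^+ 2 <= M) ->
  c \in @square_summable R.
Proof.
move=> cM; apply/asboolP; apply: nondecreasing_is_cvgn.
  by apply: nondecreasing_series => k _ _ /=; rewrite sqr_ge0.
by exists M => _ [n _ <-]; exact: cM.
Qed.

End ell2_facts.

Lemma cvg_bounded_operator (R : realType) (H K : innerProductType R)
  (A : H -> K) (u : nat -> H) (l : H) : bounded_operator A ->
  u @ \oo --> l -> (fun n => A (u n)) @ \oo --> A l.
Proof.
move=> bA /cvg_rnormP ul; have [M M0 AM] := bounded_operator_ge0 bA.
apply/cvg_rnormP.
apply: (@squeeze_cvgr _ _ _ _ (cst 0) (fun n => M * rnorm (l - u n))).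
- by near=> n; rewrite /= rnorm_ge0/= -(linear_funB _ _ bA.1).
- exact: cvg_cst.
- by rewrite -(mulr0 M); apply: cvgMr.
Unshelve. all: by end_near. Qed.

Lemma ler_sum_nat_tail (R : realType) (a : nat -> R) m n :
  (forall k, 0 <= a k) ->
  \sum_(m <= k < n) a k <= \sum_(0 <= k < n) a k.
Proof.
move=> a0; have [mn|nm] := leqP m n.
  by rewrite [leRHS](big_cat_nat (leq0n m) mn)/= lerDr sumr_ge0.
by rewrite [leLHS]big_geq ?sumr_ge0// ltnW.
Qed.

(** * Analysis and synthesis operators of Bessel sequences *)

Section Bessel.
Context (R : realType) (H : hilbertType R).
Implicit Types (Psi : nat -> H) (f : H).

(** The Bessel inequality on finite sums, which keeps the estimates inside [R]. *)
Definition bessel_bound (M : R) Psi :=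
  forall f n, \sum_(0 <= k < n) rnorm '[f, Psi k] ^+ 2 <= M * rnorm f ^+ 2.

Lemma bessel_boundP Psi : bessel Psi ->
  exists2 M : R, 0 < M & bessel_bound M Psi.
Proof.
move=> [M M0 PM]; exists M => // f n.
rewrite -lee_fin -sumEFin (le_trans _ (PM f))//.
by apply: nneseries_lim_ge => k _ _; rewrite lee_fin sqr_ge0.
Qed.

Lemma analysisE Psi f n : bessel Psi -> analysis Psi f n = '[f, Psi n].
Proof.
move=> /bessel_boundP[M _ PM]; rewrite /analysis.
have fP : (fun n => '[f, Psi n]) \in @square_summable R.
  exact: bounded_square_summable (PM f).
by rewrite -[LHS]/(val _ n) val_insubd fP.
Qed.

(** Recognizes a Bessel sequence from a bounded operator having the right coordinates; this is how
    the families of the displayed form are shown to be Bessel. *)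
Lemma bessel_of_analysis Psi (U : H -> ell2 R) : bounded_operator U ->
  (forall f n, U f n = '[f, Psi n]) -> bessel Psi /\ analysis Psi = U.
Proof.
move=> bU UE; have [M M0 UM] := bounded_operator_ge0 bU.
have bP : bessel Psi.
  (* The [+ 1] makes the bound strictly positive even when [M = 0]. *)
  exists (M ^+ 2 + 1) => [|f]; first by rewrite ltr_wpDl ?sqr_ge0.
  under eq_eseriesr do rewrite -UE.
  rewrite nneseries_ell2 lee_fin mulrDl mul1r -exprMn.
  by rewrite ler_wpDr ?sqr_ge0// ler_pXn2r ?nnegrE ?mulr_ge0 ?rnorm_ge0.
by split => //; apply/funext => f; apply: ell2P => n; rewrite analysisE// UE.
Qed.

Lemma analysis_linear Psi : bessel Psi -> linear (analysis Psi).
Proof.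
move=> bP a x y; apply: ell2P => n; rewrite analysisE//.
rewrite innerDl innerZl -!analysisE//.
Qed.

Lemma nneseries_analysis Psi f : bessel Psi ->
  (\sum_(0 <= n <oo) (rnorm '[f, Psi n] ^+ 2)%:E
   = (rnorm (analysis Psi f) ^+ 2)%:E)%E.
Proof.
move=> bP; rewrite -nneseries_ell2; apply: eq_eseriesr => n _.
by rewrite analysisE.
Qed.

Lemma analysis_bounded Psi : bessel Psi -> bounded_operator (analysis Psi).
Proof.
move=> bP; split; first exact: analysis_linear.
have [M M0 PM] := bP; exists (Num.sqrt M) => f.
rewrite -(ler_pXn2r (ltn0Sn 1)) ?nnegrE ?mulr_ge0 ?sqrtr_ge0 ?rnorm_ge0//.
by rewrite exprMn sqr_sqrtr ?(ltW M0)// -lee_fin -nneseries_analysis.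
Qed.

(** For the sum [v], expanding [<v, v>] and applying the arithmetic-geometric inequality with weight
    [M] gives [2 M |v|^2 <= M^2 sum |c_k|^2 + sum |<v, Psi k>|^2]. The Bessel bound makes the last
    sum at most [M |v|^2], which is absorbed on the left. *)
Lemma bessel_bound_sum Psi (M : R) (c : nat -> R[i]) m n : 0 < M ->
  bessel_bound M Psi ->
  rnorm (\sum_(m <= k < n) c k *: Psi k) ^+ 2
    <= M * \sum_(m <= k < n) rnorm (c k) ^+ 2.
Proof.
move=> M0 PM; set v := \sum_(m <= k < n) _.
have vv : rnorm v ^+ 2 <= \sum_(m <= k < n) rnorm (c k) * rnorm '[v, Psi k].
  have -> : rnorm v ^+ 2 = rnorm '[v, v].
    by apply: complexI; rewrite rnormE inner_rnorm ger0_norm// lecR sqr_ge0.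
  rewrite {2}/v linear_sumr/=; apply: (big_ind2 (fun a b => rnorm a <= b)).
  - by rewrite rnorm0.
  - move=> a a' b b' aa' bb'; exact: le_trans (rnormD _ _) (lerD aa' bb').
  - by move=> k _; rewrite innerZr rnormM rnorm_conjC.
have vM : \sum_(m <= k < n) rnorm '[v, Psi k] ^+ 2 <= M * rnorm v ^+ 2.
  by apply: le_trans (PM v n); apply: ler_sum_nat_tail => k; rewrite sqr_ge0.
have amgm : M * (2 * \sum_(m <= k < n) rnorm (c k) * rnorm '[v, Psi k]) <=
    M ^+ 2 * \sum_(m <= k < n) rnorm (c k) ^+ 2
      + \sum_(m <= k < n) rnorm '[v, Psi k] ^+ 2.
  rewrite !mulr_sumr -big_split/=; apply: ler_sum => k _.
  by have := sqr_ge0 (M * rnorm (c k) - rnorm '[v, Psi k]); lra.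
rewrite -(ler_pM2l M0) in vv; rewrite -(ler_pM2l M0).
by move: vv vM amgm; clear; lra.
Qed.

Lemma synthesis_cvg Psi (c : ell2 R) : bessel Psi ->
  [series c n *: Psi n]_n @ \oo --> synthesis Psi c.
Proof.
move=> /bessel_boundP[M M0 PM]; suff: cvgn [series c n *: Psi n]_n by [].
pose s := [series rnorm (c n) ^+ 2]_n.
have sc : s @ \oo --> limn s by exact: ell2_summable.
(* The Cauchy modulus is the block estimate of [bessel_bound_sum] with the block replaced by the
   whole tail of [|c|^2]. *)
apply: (@rnorm_cauchy_cvg _ _ _ (fun m => Num.sqrt (M * (limn s - s m)))).
  rewrite -[X in _ --> X](@sqrtr0 R); apply: continuous_cvg.
    exact: sqrt_continuous.
  by rewrite -(mulr0 M) -(subrr (limn s)); apply: cvgMr; apply: cvgB => //; exact: cvg_cst.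
move=> m n mn.
have ns : nondecreasing_seq s.
  by apply: nondecreasing_series => k _ _ /=; rewrite sqr_ge0.
have sl k : s k <= limn s by apply: nondecreasing_cvgn_le => //; exact: ell2_summable.
rewrite -(ler_pXn2r (ltn0Sn 1)) ?nnegrE ?sqrtr_ge0 ?rnorm_ge0//.
rewrite sqr_sqrtr ?mulr_ge0 ?(ltW M0) ?subr_ge0// sub_series_geq//.
apply: le_trans (bessel_bound_sum _ _ _ M0 PM) _.
by rewrite ler_pM2l// -sub_series_geq// lerD2r.
Qed.

Lemma synthesis_analysis_adjoint Psi : bessel Psi ->
  adjoint_pair (synthesis Psi) (analysis Psi).
Proof.
move=> bP c f.
apply: (@cvg_rnorm_unique _ R[i]^o (fun n => '[[series c n *: Psi n]_n n, f])).
  by apply: cvg_innerl; exact: synthesis_cvg.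
rewrite (_ : (fun n => _) = [series c n * (analysis Psi f n)^*]_n).
  exact: ell2_inner_cvgE.
apply/funext => n; rewrite /series/= linear_sumlz/=.
by apply: eq_bigr => k _; rewrite innerZl analysisE// -innerC.
Qed.

Lemma analysis_synthesis_adjoint Psi : bessel Psi ->
  adjoint_pair (analysis Psi) (synthesis Psi).
Proof. by move=> bP; apply/adjoint_pair_sym/synthesis_analysis_adjoint. Qed.

(** Linearity follows from adjointness alone, and the bound is that of the analysis operator. *)
Lemma synthesis_bounded Psi : bessel Psi -> bounded_operator (synthesis Psi).
Proof.
move=> bP; have PP := synthesis_analysis_adjoint bP.
split; first exact: adjoint_pair_linear PP.
have [M M0 UM] := bounded_operator_ge0 (analysis_bounded bP).
by exists M; exact: adjoint_pair_le (adjoint_pair_sym PP) UM.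
Qed.

Lemma synthesis_analysis_comp_adjoint (Phi Psi : nat -> H) : bessel Phi -> bessel Psi ->
  adjoint_pair (synthesis Phi \o analysis Psi) (synthesis Psi \o analysis Phi).
Proof.
move=> bPhi bPsi x y /=.
by rewrite synthesis_analysis_adjoint// analysis_synthesis_adjoint.
Qed.

End Bessel.

(** * The frame operator, and existence of adjoints *)

Section frame_facts.
Context (R : realType) (H : hilbertType R) (Phi : nat -> H).
Context (frPhi : frame Phi).

Lemma frame_bessel : bessel Phi.
Proof.
by have [m [M [m0 M0 PM]]] := frPhi; exists M => // f; have /andP[] := PM f.
Qed.

Lemma frame_operator_adjoint :
  adjoint_pair (frame_operator Phi) (frame_operator Phi).
Proof. exact: synthesis_analysis_comp_adjoint frame_bessel frame_bessel. Qed.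

Lemma frame_operator_bounded : bounded_operator (frame_operator Phi).
Proof.
apply: bounded_operator_comp; first exact: synthesis_bounded frame_bessel.
exact: analysis_bounded frame_bessel.
Qed.

(** Since [<S f, f> = |U f|^2], this is the lower frame inequality. *)
Lemma frame_operator_coercive : exists2 m : R, 0 < m &
  forall f, m * rnorm f ^+ 2 <= complex.Re '[frame_operator Phi f, f].
Proof.
have [m [M [m0 M0 PM]]] := frPhi; exists m => // f.
have := PM f; rewrite nneseries_analysis; last exact: frame_bessel.
rewrite !lee_fin => /andP[+ _]; rewrite -(Re_inner_rnorm (analysis Phi f)).
by rewrite -synthesis_analysis_adjoint//; exact: frame_bessel.
Qed.

(* The Riesz representative of a bounded functional [g] is
   [S^-1 (\sum_n (g (Phi n))^* *: Phi n)]. *)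
Lemma frame_adjoint_exists (K : innerProductType R) (A : H -> K) :
  bounded_operator A -> exists B, adjoint_pair A B.
Proof.
move=> bA; have [a a0 Aa] := bounded_operator_ge0 bA.
have bPhi := frame_bessel.
suff /choice[B BP] : forall y, exists z, forall x, '[A x, y] = '[x, z].
  by exists B => x y; exact: BP.
move=> y; have [M M0 PM] := bessel_boundP bPhi.
(* Let [s] be a partial sum of the squared coefficients and [v] the matching combination of the
   [Phi k]. Then [s = <A v, y>], so [s^2 <= a^2 |v|^2 |y|^2 <= a^2 |y|^2 M s]; divide by [s] when it
   is nonzero. *)
have gP : (fun n => '[y, A (Phi n)]) \in @square_summable R.
  apply: (@bounded_square_summable _ _ (a ^+ 2 * rnorm y ^+ 2 * M)) => n.
  set s := \sum_(0 <= k < n) _.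
  pose v := \sum_(0 <= k < n) '[y, A (Phi k)] *: Phi k.
  have s0 : 0 <= s by apply: sumr_ge0 => k _; rewrite sqr_ge0.
  have vs : rnorm v ^+ 2 <= M * s by exact: bessel_bound_sum.
  have sE : s = rnorm '[A v, y].
    apply: complexI; rewrite rnormE.
    suff -> : '[A v, y] = s%:C by rewrite ger0_norm// lecR.
    rewrite /v (big_morph A (fun x z => linear_funD x z bA.1) (linear_fun0 bA.1)).
    rewrite linear_sumlz/= rmorph_sum/=; apply: eq_bigr => k _.
    by rewrite (linear_funZ _ _ bA.1) innerZl rmorphXn/= rnormE normCK -innerC.
  have sy : s ^+ 2 <= (a * rnorm v * rnorm y) ^+ 2.
    rewrite ler_pXn2r ?nnegrE ?mulr_ge0 ?rnorm_ge0// sE.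
    by rewrite (le_trans (rnorm_inner _ _))// ler_wpM2r ?rnorm_ge0.
  have [s_eq0|s_neq0] := eqVneq s 0.
    by rewrite s_eq0 (mulr_ge0 _ (ltW M0))// mulr_ge0 ?sqr_ge0.
  have s_gt0 : 0 < s by rewrite lt_def s_neq0.
  rewrite -(ler_pM2r s_gt0) -expr2 (le_trans sy)// !exprMn [leLHS]mulrAC -[leRHS]mulrA.
  by rewrite ler_wpM2l// mulr_ge0 ?sqr_ge0.
pose g : ell2 R := Ell2 gP.
have [m m0 Sm] := frame_operator_coercive.
have SS := frame_operator_adjoint.
have [B [bB SB BS]] := coercive_inverse SS frame_operator_bounded m0 Sm.
exists (B (synthesis Phi g)) => x.
(* The inverse of the self-adjoint [S] is self-adjoint. *)
have -> : '[x, B (synthesis Phi g)] = '[B x, synthesis Phi g].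
  by rewrite -{1}(BS x) SS BS.
rewrite -analysis_synthesis_adjoint//.
apply/esym/(@cvg_lim R[i]^o) => //.
(* Writing [x = S (B x)] expands [x] in the frame; continuity of [A] then lets it act term by
   term. *)
have -> : '[A x, y] = '[A (synthesis Phi (analysis Phi (B x))), y].
  by rewrite -{1}(BS x).
rewrite (_ : series _ =
    fun n => '[A ([series analysis Phi (B x) k *: Phi k]_k n), y]).
  by apply: cvg_innerl; apply: cvg_bounded_operator => //; exact: synthesis_cvg.
apply/funext => n; rewrite /series/=.
rewrite (big_morph A (fun x z => linear_funD x z bA.1) (linear_fun0 bA.1)).
rewrite linear_sumlz/=; apply: eq_bigr => k _.
by rewrite (linear_funZ _ _ bA.1) innerZl -innerC.
Qed.

End frame_facts.

(** * Parametrization of the approximate duals *)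

Section approximate_duals.
Context (R : realType) (H : hilbertType R) (Phi : nat -> H).
Context (frPhi : frame Phi).
Let S12 := opsqrt (frame_operator Phi).

Lemma frame_opsqrt :
  [/\ bounded_operator S12, adjoint_pair S12 S12
    & S12 \o S12 = frame_operator Phi].
Proof.
have [m m0 Sm] := frame_operator_coercive frPhi.
by apply: (coercive_opsqrt _ _ m0 Sm);
  [exact: frame_operator_adjoint|exact: frame_operator_bounded].
Qed.

Lemma frame_opsqrt_inv :
  [/\ bounded_operator (opinv S12), adjoint_pair (opinv S12) (opinv S12),
      cancel S12 (opinv S12) & cancel (opinv S12) S12].
Proof.
have [m m0 Sm] := frame_operator_coercive frPhi.
by apply: (coercive_opsqrt_inv _ _ m0 Sm);
  [exact: frame_operator_adjoint|exact: frame_operator_bounded].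
Qed.

(* That is, the displayed [Psi] has analysis operator [U_Phi S^(-1/2) D + Theta]. *)
Lemma inner_dual_form (D : H -> H) (Theta : H -> ell2 R) f n :
  bounded_operator D -> bounded_operator Theta ->
  '[f, adjoint D (opinv S12 (Phi n)) + adjoint Theta (ell2_delta R n)] =
  analysis Phi (opinv S12 (D f)) n + Theta f n.
Proof.
move=> bD bT.
have [D' DD'] := frame_adjoint_exists frPhi bD.
have [T' TT'] := frame_adjoint_exists frPhi bT.
have [_ PP _ _] := frame_opsqrt_inv.
rewrite (adjoint_pair_eq DD') (adjoint_pair_eq TT') innerDr -DD' -TT'.
by rewrite inner_ell2_delta -PP analysisE//; exact: frame_bessel.
Qed.

Lemma frame_operator_inv f : frame_operator Phi (opinv S12 f) = S12 f.
Proof.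
have [_ _ <-] := frame_opsqrt; have [_ _ _ QP] := frame_opsqrt_inv.
by rewrite /= QP.
Qed.

Lemma dual_form_analysis (D : H -> H) (Theta : H -> ell2 R) (Psi : nat -> H) :
  bounded_operator D -> ran_synthesis Phi Theta ->
  (forall n, Psi n = adjoint D (opinv S12 (Phi n))
                     + adjoint Theta (ell2_delta R n)) ->
  bessel Psi /\ synthesis Phi \o analysis Psi = S12 \o D.
Proof.
move=> bD [bT TT0] PsiE; have bPhi := frame_bessel frPhi.
have [bP _ _ _] := frame_opsqrt_inv.
have bU : bounded_operator (fun f => analysis Phi (opinv S12 (D f)) + Theta f).
  apply: bounded_operatorD => //.
  apply: (bounded_operator_comp (analysis_bounded bPhi)).
  exact: bounded_operator_comp bP bD.
(* The coordinates computed in [inner_dual_form] give the Bessel property and the formula for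
   [analysis Psi] at once. *)
have [|bPsi UE] := @bessel_of_analysis _ _ Psi _ bU.
  by move=> f n; rewrite PsiE inner_dual_form.
split => //; apply/funext => f; rewrite /= UE.
rewrite (linear_funD _ _ (synthesis_bounded bPhi).1).
rewrite -[synthesis Phi (Theta f)]/((synthesis Phi \o Theta) f) TT0 addr0.
exact: frame_operator_inv.
Qed.

Lemma approx_dual_form (Psi : nat -> H) : bessel Psi ->
  exists (D : H -> H) (Theta : H -> ell2 R),
  [/\ ran_synthesis Phi Theta, bounded_operator D,
      synthesis Phi \o analysis Psi = S12 \o D
    & forall n, Psi n = adjoint D (opinv S12 (Phi n))
                        + adjoint Theta (ell2_delta R n)].
Proof.
move=> bPsi; have bPhi := frame_bessel frPhi.
have [bP _ QP PQ] := frame_opsqrt_inv.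
(* [D] is forced by [S12 \o D = synthesis Phi \o analysis Psi], and [Theta] by the displayed form of
   [Psi]. *)
pose D := opinv S12 \o (synthesis Phi \o analysis Psi).
pose Theta f := analysis Psi f - analysis Phi (opinv S12 (D f)).
have bT : bounded_operator (synthesis Phi) by exact: synthesis_bounded.
have bU : bounded_operator (analysis Psi) by exact: analysis_bounded.
have bD : bounded_operator D by do 2 apply: bounded_operator_comp => //.
have bTheta : bounded_operator Theta.
  apply: (bounded_operatorB bU).
  apply: (bounded_operator_comp (analysis_bounded bPhi)).
  exact: bounded_operator_comp bP bD.
exists D, Theta; split; [|exact: bD| |].
(* Applying the synthesis operator to the subtracted term gives [S S^(-1/2) D = S^(1/2) D], which
   equals [synthesis Phi \o analysis Psi] by the choice of [D]. *)
- split => //; apply/funext => f; rewrite /= /Theta (linear_funB _ _ bT.1).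
  rewrite -[synthesis Phi (analysis Phi _)]/(frame_operator Phi _).
  by rewrite frame_operator_inv /D/= PQ subrr.
- by apply/funext => f; rewrite /D/= PQ.
- move=> n; apply: inner_injr => f; rewrite inner_dual_form//.
  rewrite -analysisE// -[RHS]/((analysis Phi (opinv S12 (D f)) + Theta f : ell2 R) n).
  by rewrite /Theta addrC subrK.
Qed.

End approximate_duals.

Theorem theorem2p3 (R : realType) (H : hilbertType R) (Phi : nat -> H) :
  separable H -> frame Phi ->
  let S12 : H -> H := opsqrt (frame_operator Phi) in
  let dual_form (D : H -> H) (Theta : H -> ell2 R) (Psi : nat -> H) :=
    [/\ ran_synthesis Phi Theta,
        bounded_operator D,
        (opnorm (idfun \- (S12 \o D))%R < 1)%E
      & forall n, Psi n = adjoint D (opinv S12 (Phi n))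
                          + adjoint Theta (ell2_delta R n)] in
  (forall Psi : nat -> H, approx_dual Phi Psi <->
     exists (D : H -> H) (Theta : H -> ell2 R), dual_form D Theta Psi) /\
  (forall (D : H -> H) (Theta : H -> ell2 R) (Psi : nat -> H),
     dual_form D Theta Psi ->
     synthesis Phi \o analysis Psi = S12 \o D).
Proof.
move=> _ frPhi S12 dual_form; have bPhi := frame_bessel frPhi.
split=> [Psi|D Theta Psi [rT bD _ PsiE]]; last first.
  by have [] := dual_form_analysis frPhi bD rT PsiE.
split; last first.
  move=> [D [Th [rT bD SD1 PsiE]]].
  have [bPsi TUE] := dual_form_analysis frPhi bD rT PsiE.
  by split => //; left; rewrite TUE.
move=> [_ bPsi TU1].
have [D [Th [rT bD TUE PsiE]]] := approx_dual_form frPhi bPsi.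
exists D, Th; split => //; rewrite -TUE.
(* The first alternative is the goal; the second bounds the adjoint operator. *)
case: TU1 => //; apply: opnorm_adjoint_lt1 => x y.
by rewrite /= innerBl innerBr -(synthesis_analysis_comp_adjoint bPsi bPhi).
Qed.
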